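(* Let $X=(x_{ij})$ be a real $m\times n$ matrix. Then \[ mn\sum_{i=1}^m\sum_{j=1}^n x_{ij}^2 - n\sum_{j=1}^n\left(\sum_{i=1}^m x_{ij}\right)^2 \ \ge\ \left| m\sum_{i=1}^m\left(\sum_{j=1}^n x_{ij}\right)^2 - \left(\sum_{i=1}^m\sum_{j=1}^n x_{ij}\right)^2 \right|. \] *)

(* Defs.v *)
From mathcomp Require Import all_boot all_order all_algebra.
From mathcomp Require Import reals.

Set Implicit Arguments.
Unset Strict Implicit.
Unset Printing Implicit Defensive.

(* Main.v *)
Require Import Defs.
From mathcomp Require Import all_boot all_order all_algebra.
From mathcomp Require Import reals.
From mathcomp Require Import ring.

Set Implicit Arguments.
Unset Strict Implicit.
Unset Printing Implicit Defensive.

Import Order.TTheory GRing.Theory Num.Theory.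

Local Open Scope ring_scope.

(** Write [c j] and [r i] for the column and row sums of [X] and [s] for its
    total, and centre each column: [y i j := m * X i j - c j].  Scaling by [m]
    instead of subtracting the mean avoids division.  The [i]-th row sum of [y]
    is [m * r i - s], so the variance identity [sum_sqr_deviation], applied to
    the family [r] and to each column of [X], gives

      [\sum_i (\sum_j y i j) ^+ 2 = m * (m * \sum_i r i ^+ 2 - s ^+ 2)] and
      [n * \sum_i \sum_j y i j ^+ 2 = m * LHS],

    where [LHS] := [m * n * \sum_i \sum_j X i j ^+ 2 - n * \sum_j c j ^+ 2].
    The Cauchy-Schwarz inequality [sqr_sum_le] on each row of [y] compares the
    two; applied to [r], it shows that the absolute value is that of a
    nonnegative number.  When [m = 0] every sum vanishes; otherwise the common
    factor [m] cancels. *)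

(** The variance identity multiplied by [k ^+ 3], where the deviation of [a i]
    from the mean becomes [k * a i - \sum_j a j]. *)
Lemma sum_sqr_deviation (R : comPzRingType) (k : nat) (a : 'I_k -> R) :
  \sum_i (k%:R * a i - \sum_j a j) ^+ 2
    = k%:R * (k%:R * (\sum_i a i ^+ 2) - (\sum_i a i) ^+ 2).
Proof.
set s := \sum_j a j.
under eq_bigr => i _.
  rewrite (_ : _ ^+ 2 = k%:R ^+ 2 * a i ^+ 2 - 2 * k%:R * s * a i + s ^+ 2);
    last by ring.
  over.
rewrite big_split sumrB -!mulr_sumr sumr_const card_ord -/s /= -mulr_natl.
by ring.
Qed.

(** Cauchy-Schwarz against the constant family [1]: the defect is, up to the
    factor [k], the sum of squared deviations above. *)
Lemma sqr_sum_le (R : realDomainType) (k : nat) (a : 'I_k -> R) :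
  (\sum_i a i) ^+ 2 <= k%:R * (\sum_i a i ^+ 2).
Proof.
case: k a => [|k] a; first by rewrite !big_ord0 expr0n mulr0.
rewrite -subr_ge0 -(pmulr_rge0 _ (ltr0Sn R k)) -sum_sqr_deviation.
by apply: sumr_ge0 => i _; exact: sqr_ge0.
Qed.

Theorem corollary3p1 (R : realType) (m n : nat) (X : 'M[R]_(m, n)) :
  m%:R * n%:R * (\sum_(i < m) \sum_(j < n) X i j ^+ 2)
    - n%:R * (\sum_(j < n) (\sum_(i < m) X i j) ^+ 2)
  >= `| m%:R * (\sum_(i < m) (\sum_(j < n) X i j) ^+ 2)
        - (\sum_(i < m) \sum_(j < n) X i j) ^+ 2 |.
Proof.
rewrite ger0_norm; last by rewrite subr_ge0 sqr_sum_le.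
have [m0|m_gt0] := posnP m.
  subst m; rewrite !big_ord0 (eq_bigr (fun=> 0)); last first.
    by move=> j _; rewrite big_ord0 expr0n.
  by rewrite big1 // !mulr0 expr0n.
rewrite -(ler_pM2l (_ : 0 < m%:R)) ?ltr0n // -sum_sqr_deviation.
pose y i j := m%:R * X i j - \sum_(i' < m) X i' j.
have row_sum_y i : m%:R * (\sum_j X i j) - \sum_i' \sum_j X i' j = \sum_j y i j.
  by rewrite sumrB mulr_sumr [\sum_i' _]exchange_big.
have sum_sqr_y : n%:R * (\sum_i \sum_j y i j ^+ 2)
    = m%:R * (m%:R * n%:R * (\sum_(i < m) \sum_(j < n) X i j ^+ 2)
              - n%:R * (\sum_(j < n) (\sum_(i < m) X i j) ^+ 2)).
  rewrite exchange_big [\sum_(i < m) \sum_(j < n) X i j ^+ 2]exchange_big /=.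
  under eq_bigr => j _ do rewrite sum_sqr_deviation.
  by rewrite -mulr_sumr sumrB -mulr_sumr; ring.
rewrite -sum_sqr_y mulr_sumr; apply: ler_sum => i _.
by rewrite row_sum_y sqr_sum_le.
Qed.
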